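(* Let $G$ be a planar graph of order $n\ge 3$. Then $\mathrm{id}^{\leq 3}(G)\leq \frac{11}{6}n-\frac{8}{3}$ and $\mathrm{id}^{\leq 5}(G)\le \mathrm{id}^{\leq 4}(G)\leq \frac{4}{3}n+\frac{10}{3}$.
   Context: All graphs are finite and simple. For an oriented graph $D$ and a set $X\subseteq V(D)$, the inversion of $X$ reverses the orientation of every arc with both endvertices in $X$. For an integer $p\ge 2$, a $(\leq p)$-inversion is the inversion of a set of at most $p$ vertices. For a graph $G$, $\mathrm{id}^{\leq p}(G)$ (the $(\leq p)$-inversion diameter) is the maximum, over all ordered pairs $(\vec G_1,\vec G_2)$ of orientations of $G$ (on the same labelled vertex set), of the minimum number of $(\leq p)$-inversions whose successive application transforms $\vec G_1$ into $\vec G_2$. *)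

(* Defs.v *)
From mathcomp Require Import all_boot all_order all_algebra.
From Stdlib Require Import Rdefinitions Raxioms Ranalysis1.

Set Implicit Arguments.
Unset Strict Implicit.
Unset Printing Implicit Defensive.

(* A finite simple graph is given by a finType T of vertices and a symmetric,
   irreflexive relation e : rel T (these two conditions are hypotheses of
   the main theorem). *)

Definition in01 (t : R) : Prop := Rle R0 t /\ Rle t R1.
Definition in01o (t : R) : Prop := Rlt R0 t /\ Rlt t R1.

Definition planar (T : finType) (e : rel T) : Prop :=
  exists (pos : T -> (R * R)%type) (arc : T -> T -> R -> (R * R)%type),
    injective pos /\
    (forall u v, e u v ->
       continuity (fun t => fst (arc u v t)) /\
       continuity (fun t => snd (arc u v t)) /\
       arc u v R0 = pos u /\ arc u v R1 = pos v /\
       (forall s t, in01 s -> in01 t -> arc u v s = arc u v t -> s = t) /\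
       (forall t w, in01o t -> arc u v t <> pos w)) /\
    (forall u v x y, e u v -> e x y ->
       [set u; v] != [set x; y] :> {set T} ->
       forall s t, in01o s -> in01o t -> arc u v s <> arc x y t).

(* An orientation of (T, e) is encoded by its arc relation o : (u,v) |-> "u -> v". *)
Definition orient_rel (T : finType) := {ffun (T * T)%type -> bool}.

Definition is_orientation (T : finType) (e : rel T) (o : orient_rel T) : bool :=
  [forall u : T, forall v : T,
     (o (u, v) ==> e u v) && (e u v ==> (o (u, v) != o (v, u)))].

Definition invert (T : finType) (X : {set T}) (o : orient_rel T) : orient_rel T :=
  [ffun uv : (T * T)%type =>
     if (uv.1 \in X) && (uv.2 \in X) then o (uv.2, uv.1) else o uv].

(* o1 is transformed into o2 by exactly k successive (<= p)-inversions.
   (The empty set is a (<= p)-inversion, so this is monotone in k.) *)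
Fixpoint reachb (T : finType) (p k : nat) (o1 o2 : orient_rel T) : bool :=
  if k is k'.+1 then
    [exists X : {set T}, (#|X| <= p) && reachb p k' (invert X o1) o2]
  else o1 == o2.

(* Minimum number of (<= p)-inversions transforming o1 into o2.  The search
   range 0..#|T|^2 is always sufficient for p >= 2 (each arc can be reversed
   by inverting its two endpoints, and there are < #|T|^2 edges). *)
Definition inv_dist (T : finType) (p : nat) (o1 o2 : orient_rel T) : nat :=
  find (fun k => reachb p k o1 o2) (iota 0 (#|T| * #|T|).+1).

Definition inv_diam (T : finType) (p : nat) (e : rel T) : nat :=
  \max_(o1 : orient_rel T | is_orientation e o1)
    \max_(o2 : orient_rel T | is_orientation e o2) inv_dist p o1 o2.

(* Main.v *)
(* Two orientations of [G] differ in a set [F] of edges. Delete the vertices of [G] one by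
   one: all edges of [F] at a vertex [v] of current degree [d] are repaired by
   [ceil (d / q)] inversions of [v] with [q = p - 1] neighbours, which otherwise only
   disturb the rest of the graph. For [q = 2, 3] the rounding loss is above average only if
   [d = 1 %[mod q]]; when all degrees are of this form, deleting [v] makes the next deletion
   of a neighbour lossless. Hence [m / q + (q - 1) n / (2 q)] inversions are enough, and the
   theorem follows from [m <= 3 n - 6].

   The bound on [m] is derived from the drawing without the Jordan curve theorem. By
   compactness the drawing can be discretized, which exhibits [G] as a minor of a square
   grid. In the grid, cycles modulo 2 are the cuts of the dual grid; this property passes to
   minors, and Euler's inequality follows by counting cycles and cuts. *)

Require Import Defs.
From Stdlib Require Import ZArith Reals Lra Classical.
From mathcomp Require Import all_boot all_order all_algebra zify.

Set Implicit Arguments.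
Unset Strict Implicit.
Unset Printing Implicit Defensive.

(** * Inversions by vertex elimination *)

Section Inversions.
Variables (T : finType) (e : rel T).
Hypotheses (e_sym : symmetric e) (e_irr : irreflexive e).
Implicit Types (o : orient_rel T) (S X : {set T}) (p k : nat).

Lemma reachb_widen p p' k o1 o2 :
  p <= p' -> reachb p k o1 o2 -> reachb p' k o1 o2.
Proof.
move=> lepp'; elim: k o1 => //= k IHk o1 /existsP[X /andP[cX rX]].
by apply/existsP; exists X; rewrite (leq_trans cX lepp') IHk.
Qed.

Lemma reachb_cat p k k' o1 o2 o3 :
  reachb p k o1 o2 -> reachb p k' o2 o3 -> reachb p (k + k') o1 o3.
Proof.
elim: k o1 => [o1 /eqP->//|k IHk o1] /= /existsP[X /andP[cX rX]] r23.
by apply/existsP; exists X; rewrite cX (IHk _ rX r23).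
Qed.

Lemma orientation_off_edge o u v : is_orientation e o -> ~~ e u v -> o (u, v) = false.
Proof.
by move=> /forallP/(_ u)/forallP/(_ v)/andP[/implyP ouv _] /negP euv; apply/negP=> /ouv.
Qed.

Lemma orientation_flip o u v : is_orientation e o -> e u v -> o (v, u) = ~~ o (u, v).
Proof.
move=> /forallP/(_ u)/forallP/(_ v)/andP[_ /implyP ouv] /ouv.
by case: (o (u, v)); case: (o (v, u)).
Qed.

Lemma invert_orientation X o : is_orientation e o -> is_orientation e (invert X o).
Proof.
move=> oo; apply/forallP=> u; apply/forallP=> v; rewrite !ffunE /= [(v \in X) && _]andbC.
have [euv|neuv] := boolP (e u v).
  by rewrite (orientation_flip oo euv); case: ifP => _; case: (o (u, v)).
by rewrite (orientation_off_edge oo neuv) orientation_off_edge ?if_same // e_sym.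
Qed.

Definition agree_off S o o' :=
  forall u w, ~~ ((u \in S) && (w \in S)) -> o (u, w) = o' (u, w).

Definition deg_in S v := #|[set u in S | e v u]|.

(** Inverting [v] together with [q] neighbours along wrong edges corrects these edges; the other
    arcs it reverses lie inside [S :\ v], where no agreement is claimed. Each round removes up to
    [q] wrong edges at [v]. *)
Lemma clear_vertex q k S v o1 o2 :
    is_orientation e o1 -> is_orientation e o2 -> v \in S -> agree_off S o1 o2 ->
    #|[set u in S | e v u & o1 (v, u) != o2 (v, u)]| <= k * q ->
  exists2 o, is_orientation e o & reachb q.+1 k o1 o /\ agree_off (S :\ v) o o2.
Proof.
move=> oo1 oo2 vS; elim: k o1 oo1 => [|k IHk] o1 oo1 agr.
  rewrite leqn0 cards_eq0 => /eqP A0; exists o1 => //; split=> //= u w.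
  have vw x : x \in S -> o1 (v, x) = o2 (v, x).
    move=> xS; have [evx|nevx] := boolP (e v x); last by rewrite !orientation_off_edge.
    move/setP/(_ x): A0; rewrite !inE xS evx /=.
    by move/negbFE/eqP.
  rewrite !inE; have [->|nuv] := eqVneq u v => /= [_|].
    by have [/vw//|wS] := boolP (w \in S); apply: agr; rewrite (negPf wS) andbF.
  have [->|nwv] := eqVneq w v => /= [_|]; last exact: agr.
  have [uS|uS] := boolP (u \in S); last by apply: agr; rewrite (negPf uS).
  have [evx|nevx] := boolP (e v u); first by rewrite !(orientation_flip _ evx) // vw.
  by rewrite !orientation_off_edge // e_sym.
set A := [set _ in _ | _ & _] => cA.
(* [q] of the wrong neighbours, or all of them when fewer are left. *)
pose B := [set x in take q (enum A)].
have sBA : B \subset A.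
  by apply/subsetP=> x; rewrite inE => /mem_take; rewrite mem_enum.
have cB : #|B| = minn q #|A|.
  by rewrite cardsE (card_uniqP _) ?take_uniq ?enum_uniq // size_take_min -cardE.
have vB : v \notin B by apply: contraTN vS => /(subsetP sBA); rewrite inE e_irr andbF.
have [|||o oo [ro agr']] := IHk (invert (v |: B) o1).
- exact: invert_orientation.
- move=> u w nuw; rewrite ffunE /= !in_setU1; case: ifP => [|_]; last exact: agr.
  have BS x : x \in B -> x \in S by move/(subsetP sBA); rewrite inE => /andP[].
  case/andP=> /predU1P Hu /predU1P Hw; case/negP: nuw.
  by apply/andP; split; [case: Hu => [->|/BS]|case: Hw => [->|/BS]].
- apply: (@leq_trans #|A :\: B|); last by rewrite cardsD (setIidPr sBA) cB; lia.
  apply/subset_leq_card/subsetP=> x; rewrite !inE !ffunE /= !inE eqxx /=.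
  case: (eqVneq x v) => [->|nxv]; first by rewrite e_irr andbF.
  case xB: (x \in take q (enum A)) => //=.
  have := subsetP sBA x; rewrite !inE xB => /(_ isT) /and3P[xS evx].
  by rewrite xS evx (orientation_flip oo1 evx) /=; case: (o1 _); case: (o2 _).
exists o => //; split=> //=; apply/existsP; exists (v |: B).
by rewrite ro andbT cardsU1 vB cB; lia.
Qed.

Lemma clear_vertex_deg q k S v o1 o2 :
    is_orientation e o1 -> is_orientation e o2 -> v \in S -> agree_off S o1 o2 ->
    deg_in S v <= k * q ->
  exists2 o, is_orientation e o & reachb q.+1 k o1 o /\ agree_off (S :\ v) o o2.
Proof.
move=> oo1 oo2 vS agr dk; apply: (clear_vertex oo1 oo2 vS agr).
apply: leq_trans dk; apply/subset_leq_card/subsetP=> x.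
by rewrite !inE => /and3P[-> ->].
Qed.

(** Twice the number of edges inside [S]. *)
Definition deg_sum S := \sum_(u in S) deg_in S u.

Lemma deg_in_setD1 S u v : v \in S -> deg_in S u = e u v + deg_in (S :\ v) u.
Proof.
move=> vS; rewrite /deg_in (cardsD1 v) !inE vS /=; congr (_ + _).
by apply: eq_card => x; rewrite !inE andbA.
Qed.

Lemma deg_sum_setD1 S v : v \in S -> deg_sum S = deg_sum (S :\ v) + (deg_in S v).*2.
Proof.
move=> vS; rewrite /deg_sum (big_setD1 v) //=.
under eq_bigr => u _ do rewrite (deg_in_setD1 u vS).
rewrite big_split /=; suff -> : \sum_(u in S :\ v) e u v = deg_in S v by lia.
rewrite /deg_in -sum1_card big_mkcond [RHS]big_mkcond /=; apply: eq_bigr => u _.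
rewrite !inE e_sym; have [->|_] := eqVneq u v; first by rewrite e_irr andbF.
by case: (u \in S); case: (e v u).
Qed.

Lemma deg_in_gt0 S v : 0 < deg_in S v -> exists2 u, u \in S & e v u.
Proof. by case/card_gt0P=> u; rewrite inE => /andP[]; exists u. Qed.

(** The potential [deg_sum S + q.-1 * #|S|] pays [2 * q] per inversion. Removing a vertex of degree
    d releases 2d + q - 1 and costs 2q ceil(d / q). This is covered unless d = 1 mod q, when the
    deficit is exactly q - 1. *)
Lemma reachb_elimination q S o1 o2 :
    1 < q <= 3 -> is_orientation e o1 -> is_orientation e o2 -> agree_off S o1 o2 ->
  exists2 k, reachb q.+1 k o1 o2 & 2 * q * k <= deg_sum S + q.-1 * #|S|.
Proof.
move=> q23 oo1 oo2; have [n] := ubnP #|S|.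
elim: n => // n IHn in S o1 oo1 * => cS agr.
have [S0|[v0 v0S]] := set_0Vmem S.
  exists 0; rewrite ?muln0 //=; apply/eqP/ffunP=> -[u w].
  by apply: agr; rewrite S0 !inE.
pose good v := deg_in S v %% q != 1.
have [/existsP[v /andP[vS gv]]|/existsPn bad] := boolP [exists v, (v \in S) && good v].
  have [|o oo [ro agr']] := @clear_vertex_deg q ((deg_in S v + q.-1) %/ q) _ _ _ _ oo1 oo2 vS agr.
    by move: q23 => /andP[]; case: q {gv good IHn} => [|[|[|[|]]]] // _ _; lia.
  have cSv := cardsD1 v S; rewrite vS in cSv.
  have [|k rk lek] := IHn _ _ oo _ agr'; first by lia.
  exists ((deg_in S v + q.-1) %/ q + k); first exact: reachb_cat ro rk.
  rewrite (deg_sum_setD1 vS) cSv; move: q23 gv lek; rewrite /good => /andP[].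
  by case: q {good IHn ro rk} => [|[|[|[|]]]] //= _ _; lia.
have badS v : v \in S -> deg_in S v %% q = 1.
  by move=> vS; apply/eqP; have:= bad v; rewrite vS /= negbK.
have dv0 := badS _ v0S.
have [|u uS evu] := @deg_in_gt0 S v0; first by case: (deg_in S v0) dv0 => //; rewrite mod0n.
have nuv : u != v0 by apply: contraTneq evu => ->; rewrite e_irr.
have uSv : u \in S :\ v0 by rewrite !inE nuv.
(* Once [v0] is gone, the degree of [u] is divisible by [q]: removing [u] involves no rounding, and
   its spare q - 1 covers the deficit of [v0]. *)
have du : deg_in S u = (deg_in (S :\ v0) u).+1 by rewrite (deg_in_setD1 _ v0S) e_sym evu.
have duS := badS _ uS; rewrite du in duS.
have [|o oo [ro agr']] :=
    @clear_vertex_deg q ((deg_in S v0 + q.-1) %/ q) _ _ _ _ oo1 oo2 v0S agr.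
  by move: q23 => /andP[]; case: q {IHn good bad badS dv0 duS} => [|[|[|[|]]]] // _ _; lia.
have [|o' oo' [ro' agr'']] :=
    @clear_vertex_deg q (deg_in (S :\ v0) u %/ q) _ _ _ _ oo oo2 uSv agr'.
  by move: q23 duS => /andP[]; case: q {IHn good bad badS dv0 ro} => [|[|[|[|]]]] // _ _; lia.
have cSv := cardsD1 v0 S; rewrite v0S in cSv.
have cSu := cardsD1 u (S :\ v0); rewrite uSv in cSu.
have [|k rk lek] := IHn _ _ oo' _ agr''; first by lia.
exists ((deg_in S v0 + q.-1) %/ q + (deg_in (S :\ v0) u %/ q + k)).
  exact: reachb_cat ro (reachb_cat ro' rk).
rewrite (deg_sum_setD1 v0S) (deg_sum_setD1 uSv) cSv cSu; move: q23 dv0 duS lek => /andP[].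
by case: q {IHn good bad badS ro ro' rk} => [|[|[|[|]]]] //= _ _; lia.
Qed.

Lemma inv_dist_leq p k o1 o2 :
  k <= #|T| * #|T| -> reachb p k o1 o2 -> inv_dist p o1 o2 <= k.
Proof.
move=> lek rk; rewrite /inv_dist leqNgt; apply/negP=> /(before_find 0).
by rewrite nth_iota ?ltnS // add0n rk.
Qed.

Lemma inv_diam_anti p p' : p <= p' -> inv_diam p' e <= inv_diam p e.
Proof.
move=> lepp'; apply/bigmax_leqP=> o1 oo1; apply/bigmax_leqP=> o2 oo2.
apply: leq_trans (leq_bigmax_cond _ oo1); apply: leq_trans (leq_bigmax_cond _ oo2).
by apply: sub_find => k; apply: reachb_widen.
Qed.

Lemma inv_diam_leq q :
    1 < q <= 3 -> 1 < #|T| -> deg_sum [set: T] <= 6 * #|T| ->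
  2 * q * inv_diam q.+1 e <= deg_sum [set: T] + q.-1 * #|T|.
Proof.
move=> q23 T_gt1 dT; have q_gt0 : 0 < 2 * q by lia.
rewrite [leqLHS]mulnC -leq_divRL //.
apply/bigmax_leqP=> o1 oo1; apply/bigmax_leqP=> o2 oo2.
have [|k rk] := @reachb_elimination q [set: T] o1 o2 q23 oo1 oo2.
  by move=> u w; rewrite !inE.
rewrite cardsT => lek; rewrite leq_divRL //.
rewrite mulnC; apply: (leq_trans _ lek); rewrite leq_mul2l inv_dist_leq ?orbT //.
(* The elimination takes at most 2n inversions, and 2n <= n^2 puts this number inside the search
   range of [inv_dist]. *)
have : 2 * #|T| <= #|T| * #|T| by rewrite leq_mul2r T_gt1 orbT.
by move: lek dT; case: q q23 {q_gt0 rk} => [|[|[|[|]]]] //= _; lia.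
Qed.
End Inversions.

(** * Cycles modulo 2 and abstract duals *)

Section Chains.
Variables (Q C : finType) (s t : Q -> C).
Implicit Types (Y Z : Q -> bool) (c : C) (q : Q).

(** The boundary over the field with two elements; chains are added by [(+)] and a loop contributes
    nothing. *)
Definition bdry Z c := \big[addb/false]_q (Z q && ((s q == c) (+) (t q == c))).

Lemma eq_bdry Y Z c : Y =1 Z -> bdry Y c = bdry Z c.
Proof. by move=> eqYZ; apply: eq_bigr => q _; rewrite eqYZ. Qed.

Lemma bdryD Y Z c : bdry (fun q => Y q (+) Z q) c = bdry Y c (+) bdry Z c.
Proof. by rewrite /bdry -big_split; apply: eq_bigr => q _; rewrite andb_addl. Qed.

Lemma big_addb_eq (I : finType) (i0 : I) (F : I -> bool) :
  \big[addb/false]_i ((i0 == i) && F i) = F i0.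
Proof.
rewrite (bigD1 i0) //= eqxx big1 ?addbF // => i; rewrite eq_sym.
by move/negPf->.
Qed.

(** Double counting of incidences: only edges leaving [P] survive. With [P] everything, the
    boundaries sum to zero; with [P] a branch set, this is the boundary after contraction. *)
Lemma bdry_sum (P : C -> bool) Z :
  \big[addb/false]_c (P c && bdry Z c) =
  \big[addb/false]_q (Z q && (P (s q) (+) P (t q))).
Proof.
under eq_bigr do rewrite big_distrr /=.
rewrite exchange_big; apply: eq_bigr => q _ /=.
under eq_bigr do rewrite andbCA andb_addr [P _ && _]andbC [P _ && (t q == _)]andbC.
by rewrite -big_distrr big_split /= !big_addb_eq.
Qed.

End Chains.

(* Euler's inequality by counting: there are at least [2 ^ (m - n + 1)] cycles and at most
   [2 ^ (f - 1)] cuts of the dual, and a face of a simple graph has at least 3 edges. *)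
Section AbstractDual.
Variables (V E Phi : finType) (a b : E -> V) (l r : E -> Phi).
Hypothesis a_neq_b : forall x, a x != b x.
Hypothesis simple : forall x y, [set a x; b x] = [set a y; b y] -> x = y.
Hypothesis cycle_cut : forall Z : E -> bool,
  (forall v, bdry a b Z v = false) -> exists f : Phi -> bool, forall x, Z x = f (l x) (+) f (r x).
Hypothesis star_cycle : forall phi v,
  bdry a b (fun x => (l x == phi) (+) (r x == phi)) v = false.

Definition cycles := [set Z : {ffun E -> bool} | [forall v, ~~ bdry a b Z v]].

Lemma cyclesP (Z : {ffun E -> bool}) :
  reflect (forall v, bdry a b Z v = false) (Z \in cycles).
Proof. by rewrite inE; apply: (iffP forallP) => H v; [apply/negbTE | rewrite H]. Qed.

(** Rank-nullity as a count: [D] takes at most 2^(n - 1) values, since it ignores [v0], and each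
    fibre is a translate of a set of cycles. The boundary at [v0] vanishes with the others because
    all of them sum to zero. *)
Lemma card_cycles (v0 : V) : 2 ^ #|E| <= 2 ^ #|V|.-1 * #|cycles|.
Proof.
pose D (Z : {ffun E -> bool}) := [ffun v => (v != v0) && bdry a b Z v].
have DD (Z : {ffun E -> bool}) : D Z \in pffun_on false (predC1 v0) predT.
  apply/pffun_onP; split=> //; apply/subsetP=> v.
  by rewrite unfold_in /= ffunE; apply: contraNneq => ->; rewrite eqxx.
have := card_pffun_on false (mem (predC1 v0)) (mem (predT : pred bool)).
rewrite cardC1 card_bool => <-; rewrite -[2 in leqLHS]card_bool -card_ffun -[leqLHS]sum1_card.
rewrite (partition_big D (fun y => y \in pffun_on false (predC1 v0) predT)) //=.
rewrite -sum_nat_const /=; apply: leq_sum => y _.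
rewrite sum1_card; have [Z0|] := pickP (fun Z => D Z == y); last first.
  by move=> y0; rewrite eq_card0 // => Z; rewrite unfold_in y0.
move=> /eqP Z0y.
pose h (Z : {ffun E -> bool}) := [ffun x => Z x (+) Z0 x].
have h_inj : injective h.
  move=> Z Z' /ffunP hZ; apply/ffunP=> x; have:= hZ x; rewrite !ffunE.
  by case: (Z x); case: (Z' x); case: (Z0 x).
rewrite -(card_imset _ h_inj); apply/subset_leq_card/subsetP=> _ /imsetP[Z Zin ->].
have Zy : D Z = y by apply/eqP; exact: Zin.
apply/cyclesP.
have hE v : bdry a b (h Z) v = bdry a b Z v (+) bdry a b Z0 v.
  by rewrite -bdryD; apply: eq_bdry => x; rewrite ffunE.
have h0 v : v != v0 -> bdry a b (h Z) v = false.
  move=> nv; have /ffunP/(_ v): D Z = D Z0 by rewrite Zy Z0y.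
  by rewrite !ffunE nv hE /= => ->; rewrite addbb.
move=> v; have [->|/h0//] := eqVneq v v0.
have := bdry_sum a b predT (h Z); rewrite [RHS]big1 => [|x _]; last by rewrite andbF.
by rewrite (bigD1 v0) //= big1 ?addbF // => w /h0.
Qed.

Lemma incident_other (Z : E -> bool) x v : bdry a b Z v = false -> Z x ->
  (a x == v) (+) (b x == v) -> exists2 y, Z y & (y != x) && (v \in [set a y; b y]).
Proof.
move=> Zv Zx xv; have [y /and3P[]|no] := pickP [pred y | [&& Z y, y != x & v \in [set a y; b y]]].
  by move=> Zy nyx vy; exists y; rewrite ?nyx.
move: Zv; rewrite /bdry (bigD1 x) //= Zx xv big1 // => y nyx.
apply: contraFF (no y) => /andP[Zy yv] /=; rewrite Zy nyx !inE.
by move: yv; rewrite ![v == _]eq_sym; case: eqP; case: eqP.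
Qed.

(** By parity a cycle through [x] has another edge at each end of [x]. If these two were the same
    edge, it would be parallel to [x]. *)
Lemma cycle_card_ge3 (Z : E -> bool) x : (forall v, bdry a b Z v = false) -> Z x ->
  2 < #|[set y | Z y]|.
Proof.
move=> Zc Zx; have nab := a_neq_b x.
have [|y Zy /andP[nyx ay]] := incident_other (Zc (a x)) Zx.
  by rewrite eqxx eq_sym (negPf nab).
have [|z Zz /andP[nzx bz]] := incident_other (Zc (b x)) Zx.
  by rewrite eqxx (negPf nab).
have nyz : y != z.
  apply: contraNneq nyx => yz; apply/eqP/simple/esym/eqP; rewrite -yz in bz.
  rewrite eqEcard !cards2 nab (a_neq_b y) andbT.
  by apply/subsetP=> w; rewrite !inE => /orP[] /eqP->; [move: ay | move: bz]; rewrite !inE.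
have sub : [set x; y; z] \subset [set y | Z y].
  by apply/subsetP=> w; rewrite !inE => /orP[/orP[]|] /eqP->.
apply: leq_trans (subset_leq_card sub).
by rewrite -setUA cardsU1 cards2 nyz !inE eq_sym (negPf nyx) eq_sym (negPf nzx).
Qed.

Definition star phi := [set x | (l x == phi) (+) (r x == phi)].
(** Faces with an empty star affect no cut; only the others are forced to have three edges. *)
Definition proper_faces := [set phi | star phi != set0].

(** A nonempty star is a cycle, so it has at least three edges, and every edge lies in at most two
    stars. *)
Lemma card_proper_faces : 3 * #|proper_faces| <= 2 * #|E|.
Proof.
apply: (@leq_trans (\sum_phi #|star phi|)).
  rewrite mulnC -sum_nat_const [leqRHS](bigID (mem proper_faces)) /=.
  rewrite -[leqLHS]addn0 leq_add // leq_sum // => phi; rewrite inE => /set0Pn[x].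
  by rewrite inE => xphi; apply: (@cycle_card_ge3 _ x).
under eq_bigr do rewrite -sum1_card big_mkcond /=.
rewrite exchange_big /= mulnC -sum_nat_const; apply: leq_sum => x _.
apply: (@leq_trans (\sum_phi ((l x == phi) + (r x == phi)))).
  by apply: leq_sum => phi _; rewrite inE; case: eqP; case: eqP.
have sum1 y : \sum_phi (y == phi :> Phi) = 1.
  by rewrite (bigD1 y) //= eqxx big1 // => phi; rewrite eq_sym => /negPf->.
by rewrite big_split /= !sum1.
Qed.

Lemma card_cycles_faces : #|cycles| <= 2 ^ #|proper_faces|.-1.
Proof.
have PhiP x : l x != r x -> (l x \in proper_faces) && (r x \in proper_faces).
  move=> nlr; rewrite !inE; apply/andP; split; apply/set0Pn; exists x; rewrite inE eqxx.
    by rewrite eq_sym (negPf nlr).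
  by rewrite (negPf nlr).
have [P0|[phi0 phi0P]] := set_0Vmem proper_faces.
  (* Without proper faces every dual edge is a loop, so all cuts, hence all cycles, are empty. *)
  rewrite P0 cards0 /= expn0 -(cards1 [ffun _ : E => false]).
  apply/subset_leq_card/subsetP=> Z /cyclesP /cycle_cut[f Zf].
  rewrite inE; apply/eqP/ffunP=> x; rewrite ffunE Zf.
  have [->|/PhiP] := eqVneq (l x) (r x); first by rewrite addbb.
  by rewrite P0 inE.
pose D := proper_faces :\ phi0.
have cD : #|D| = #|proper_faces|.-1 by rewrite (cardsD1 phi0 proper_faces) phi0P.
have := card_pffun_on false (mem D) (mem (predT : pred bool)).
rewrite card_bool cD => <-.
pose cut (f : {ffun Phi -> bool}) := [ffun x => f (l x) (+) f (r x)].
apply: leq_trans (leq_imset_card cut _).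
apply/subset_leq_card/subsetP=> Z /cyclesP /cycle_cut[f Zf].
(* Adding the constant [f phi0] leaves the cut unchanged and makes the potential vanish at [phi0],
   which saves one factor of 2. *)
apply/imsetP; exists [ffun phi => (phi \in proper_faces) && (f phi (+) f phi0)].
  apply/pffun_onP; split=> //; apply/subsetP=> phi.
  rewrite unfold_in /= ffunE !inE; have [->|_] := eqVneq phi phi0; first by rewrite addbb andbF.
  by case: (star phi != set0).
apply/ffunP=> x; rewrite !ffunE Zf.
have [->|/PhiP/andP[-> ->]] := eqVneq (l x) (r x); first by rewrite !addbb.
by rewrite /= addbACA addbb addbF.
Qed.

Lemma dual_edge_bound : 2 < #|V| -> #|E| + 6 <= 3 * #|V|.
Proof.
move=> V3; have /card_gt0P[v0 _] : 0 < #|V| by lia.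
have := card_proper_faces.
have := leq_trans (card_cycles v0) (leq_mul (leqnn _) card_cycles_faces).
(* With F proper faces, m <= (n - 1) + (F - 1) and 3F <= 2m. For F = 0 the predecessor truncates,
   but then m <= n - 1 suffices as n >= 3. *)
rewrite -expnD leq_exp2l //; lia.
Qed.

End AbstractDual.

(* If a graph with edge set [E] is a minor of a host graph [Q] with dual [Phi], then the
   dual of the minor is obtained from [Phi] by contracting the duals of the deleted edges. *)
Section MinorDual.
Variables (Q C Phi V E : finType).
Variables (s t : Q -> C) (l r : Q -> Phi) (a b : E -> V).
Variables (br : C -> option V) (rep : E -> Q) (cen : V -> C) (W : E -> Q -> bool).

(** The contracted host edges. In this minor model [br] names the branch set of a host vertex,
    [rep x] is the host edge kept for [x], and the chain [W x] joins the centres of two branch sets,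
    leaving them only through [rep x]. *)
Definition inner q := isSome (br (s q)) && (br (s q) == br (t q)).

Hypothesis a_neq_b : forall x, a x != b x.
Hypothesis simple : forall x y, [set a x; b x] = [set a y; b y] -> x = y.
Hypothesis rep_ends : forall x,
  br (s (rep x)) = Some (a x) /\ br (t (rep x)) = Some (b x) \/
  br (s (rep x)) = Some (b x) /\ br (t (rep x)) = Some (a x).
Hypothesis W_rep : forall x, W x (rep x).
Hypothesis W_supp : forall x q, W x q -> q = rep x \/ inner q.
Hypothesis W_bdry : forall x c, bdry s t (W x) c = (cen (a x) == c) (+) (cen (b x) == c).
Hypothesis host_cycle_cut : forall Z : Q -> bool,
  (forall q, Z q -> br (s q) && br (t q)) -> (forall c, bdry s t Z c = false) ->
  exists f : Phi -> bool, forall q, Z q = f (l q) (+) f (r q).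
Hypothesis host_cut_cycle : forall (g : Phi -> bool) c, br c ->
  bdry s t (fun q => g (l q) (+) g (r q)) c = false.

Lemma rep_inj : injective rep.
Proof.
move=> x y rxy; apply: simple.
move: (rep_ends x) (rep_ends y); rewrite rxy.
by case=> -[-> ->] [] [[->] [->]] //; rewrite setUC.
Qed.

Lemma rep_inner x : inner (rep x) = false.
Proof.
have nab := negPf (a_neq_b x).
by rewrite /inner; case: (rep_ends x) => -[-> ->] /=; rewrite (inj_eq Some_inj) // eq_sym.
Qed.

Definition deleted q := ~~ inner q && (q \notin codom rep).

Definition dadj phi psi := [exists q, deleted q &&
  ((l q == phi) && (r q == psi) || (r q == phi) && (l q == psi))].

Lemma dadj_connect_sym : connect_sym dadj.
Proof.
apply: sym_connect_sym => phi psi; apply: eq_existsb => q.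
by rewrite orbC [(r q == phi) && _]andbC [(l q == phi) && _]andbC.
Qed.

Definition face phi := fingraph.root dadj phi.

Lemma face_deleted q : deleted q -> face (l q) = face (r q).
Proof.
move=> dq; apply/(fingraph.rootP dadj_connect_sym)/connect1/existsP.
by exists q; rewrite dq !eqxx.
Qed.

(** Lift [Z] to the host cycle [Z'], the sum of the chains [W x] over [Z], and write it as the cut
    of [f]. As [Z'] avoids deleted edges, [f] is constant on merged faces; on [rep x] only [W x]
    contributes, so [Z'] has the value [Z x] there. *)
Lemma minor_cycle_cut (Z : E -> bool) : (forall v, bdry a b Z v = false) ->
  exists f : Phi -> bool, forall x, Z x = f (face (l (rep x))) (+) f (face (r (rep x))).
Proof.
move=> Z0; pose Z' q := \big[addb/false]_x (Z x && W x q).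
have Z'P q : Z' q -> exists x, W x q.
  move=> Zq; apply/existsP; apply: contraTT Zq => /existsPn no.
  by rewrite /Z' big1 // => x _; rewrite (negPf (no x)) andbF.
have [|c|f Z'f] := @host_cycle_cut Z'.
- move=> q /Z'P[x /W_supp[->|]]; first by case: (rep_ends x) => -[-> ->].
  by rewrite /inner => /andP[brq /eqP <-]; rewrite brq.
- rewrite /bdry /Z'; under eq_bigr do rewrite big_distrl /=.
  rewrite exchange_big /=; under eq_bigr do under eq_bigr do rewrite -andbA.
  under eq_bigr => x _ do rewrite -big_distrr /= -/(bdry s t (W x) c) W_bdry.
  rewrite -(bdry_sum a b (fun v => cen v == c)).
  by rewrite big1 // => v _; rewrite Z0 andbF.
exists f => x.
have fD phi psi : dadj phi psi -> f phi = f psi.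
  case/existsP=> q /andP[/andP[ninn ncod]].
  suff: f (l q) = f (r q) by move=> fq /orP[] /andP[/eqP<- /eqP<-].
  apply/eqP; rewrite -negb_add -Z'f; apply/negP=> /Z'P[y /W_supp[qy|inn]]; last by rewrite inn in ninn.
  by rewrite qy codom_f in ncod.
have ff phi : f (face phi) = f phi.
  rewrite /face; have /connectP[p pp ->] := connect_root dadj phi.
  by elim: p phi pp => //= psi p IHp phi /andP[/fD-> /IHp].
rewrite !ff -Z'f /Z'; rewrite -[LHS](big_addb_eq x).
apply: eq_bigr => y _; have [<-|nxy] := eqVneq x y; first by rewrite W_rep andbT.
rewrite /=; apply/esym/negP=> /andP[_ /W_supp[/rep_inj xy|]].
  by rewrite xy eqxx in nxy.
by rewrite rep_inner.
Qed.

(** Pull [phi] back to a host cut, which is a cycle, and sum its boundary over the branch set of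
    [v]. Inner edges cancel, deleted edges have the same face on both sides, and the edges [rep x]
    remain. *)
Lemma minor_star_cycle phi v :
  bdry a b (fun x => (face (l (rep x)) == phi) (+) (face (r (rep x)) == phi)) v = false.
Proof.
pose g psi := face psi == phi.
have := bdry_sum s t (fun c => br c == Some v) (fun q => g (l q) (+) g (r q)).
rewrite [LHS]big1 => [/esym|c _]; last first.
  by case: eqP => //= brc; rewrite host_cut_cycle // brc.
move=> H; rewrite -[RHS]H; symmetry.
pose F q := (g (l q) (+) g (r q)) && ((br (s q) == Some v) (+) (br (t q) == Some v)).
rewrite (eq_bigr (fun q => \big[addb/false]_x ((rep x == q) && F q))) => [|q _].
  rewrite exchange_big /=; apply: eq_bigr => x _; rewrite big_addb_eq /F /g.
  congr (_ && _).
  by case: (rep_ends x) => -[-> ->]; rewrite !(inj_eq Some_inj) // addbC.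
rewrite -/(F q); have [/codomP[y ->]|nq] := boolP (q \in codom rep).
  rewrite -[LHS](big_addb_eq y (fun _ => F (rep y))).
  by apply: eq_bigr => x _; rewrite (inj_eq rep_inj) eq_sym.
rewrite big1 => [|x _]; last by case: eqP => // qx; rewrite -qx codom_f in nq.
have [inn|ninn] := boolP (inner q).
  by rewrite /F; move: inn => /andP[_ /eqP->]; rewrite addbb andbF.
by rewrite /F /g face_deleted ?addbb // /deleted ninn.
Qed.

Lemma minor_edge_bound : 2 < #|V| -> #|E| + 6 <= 3 * #|V|.
Proof.
exact: (dual_edge_bound a_neq_b simple minor_cycle_cut minor_star_cycle).
Qed.
End MinorDual.

(** * Minors of the square grid *)

(* The cells of a square grid, with the corners of the cells as dual vertices. The grid
   edge [(true, c)] leads from [c] to the next cell in the first coordinate, [(false, c)]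
   to the next one in the second coordinate; corner [c] is the far corner of cell [c].
   At the border [inord] yields junk, which is harmless as chains only use cells with
   positive coordinates. *)
Section Grid.
Variable M : nat.
Let C : finType := ('I_M.+1 * 'I_M.+1)%type.
Let Q : finType := (bool * C)%type.
Implicit Types (c : C) (q : Q) (Z : Q -> bool).

Definition grid_src q : C := q.2.
Definition grid_tgt q : C :=
  if q.1 then (inord q.2.1.+1, q.2.2) else (q.2.1, inord q.2.2.+1).
Definition grid_left q : C :=
  if q.1 then (q.2.1, inord q.2.2.-1) else (inord q.2.1.-1, q.2.2).
Definition interior c := (0 < c.1) && (0 < c.2).

(** At the border [inord M.+1] falls back to 0, which differs from the positive [k], so the
    equivalence survives there. *)
Lemma inord_succ_eq (i k : 'I_M.+1) : 0 < k -> (inord i.+1 == k) = (inord k.-1 == i).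
Proof.
move=> k0; have kM := ltn_ord k; have iM := ltn_ord i.
rewrite -!val_eqE /= (@inordK _ k.-1); last by lia.
have [iM'|iM'] := leqP i.+1 M; first by rewrite inordK //; lia.
have -> : inord i.+1 = ord0 :> 'I_M.+1.
  by apply: val_inj; rewrite /= /inord val_insubd; case: ifP => //; lia.
by rewrite /=; lia.
Qed.

Lemma big_addb_bool_prod (F : Q -> bool) :
  \big[addb/false]_q F q =
  \big[addb/false]_c F (true, c) (+) \big[addb/false]_c F (false, c).
Proof.
rewrite (eq_bigr (fun q => F (q.1, q.2))) => [|[] //].
by rewrite -(pair_bigA _ (fun d c => F (d, c))) big_bool.
Qed.

Lemma grid_bdryE Z c : interior c ->
  bdry grid_src grid_tgt Z c =
    (Z (true, c) (+) Z (false, c)) (+)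
    (Z (true, (inord c.1.-1, c.2)) (+) Z (false, (c.1, inord c.2.-1))).
Proof.
case: c => i j /andP[/= i0 j0]; rewrite /bdry.
under eq_bigr do rewrite andb_addr.
rewrite big_split /= !big_addb_bool_prod /grid_src /grid_tgt /=; congr (_ (+) _ (+) (_ (+) _)).
- rewrite -[RHS](big_addb_eq (i, j) (fun c => Z (true, c))).
  by apply: eq_bigr => c _; rewrite andbC eq_sym.
- rewrite -[RHS](big_addb_eq (i, j) (fun c => Z (false, c))).
  by apply: eq_bigr => c _; rewrite andbC eq_sym.
- rewrite -[RHS](big_addb_eq (inord i.-1, j) (fun c => Z (true, c))).
  apply: eq_bigr => -[i' j'] _; rewrite andbC !xpair_eqE inord_succ_eq //=.
  by rewrite [j' == _]eq_sym.
- rewrite -[RHS](big_addb_eq (i, inord j.-1) (fun c => Z (false, c))).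
  apply: eq_bigr => -[i' j'] _; rewrite andbC !xpair_eqE inord_succ_eq //=.
  by rewrite [i' == _]eq_sym.
Qed.

(** The four edges at a cell run around its four corners, and each corner is counted twice. *)
Lemma grid_cut_cycle (g : C -> bool) c : interior c ->
  bdry grid_src grid_tgt (fun q => g (grid_left q) (+) g (grid_src q)) c = false.
Proof.
move=> ci; rewrite grid_bdryE // /grid_left /grid_src /=; case: c ci => i j _ /=.
by do 4 case: (g _).
Qed.

(* The dual potential counts the chain edges crossed on the way from the border. *)
Lemma grid_cycle_cut Z :
    (forall q, Z q -> interior (grid_src q)) ->
    (forall c, bdry grid_src grid_tgt Z c = false) ->
  exists f : C -> bool, forall q, Z q = f (grid_left q) (+) f (grid_src q).
Proof.
move=> Zint Z0.
pose F n (j : 'I_M.+1) := \big[addb/false]_(k < n.+1) Z (false, (inord k, j)).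
have Zout q : ~~ interior (grid_src q) -> Z q = false.
  by move=> nq; apply: contraNF nq => /Zint.
have FS n j : F n.+1 j = F n j (+) Z (false, (inord n.+1, j)).
  by rewrite /F big_ord_recr.
have F0 j : F 0 j = false.
  by rewrite /F big_ord_recl big_ord0 Zout // /interior /= inordK.
(* The induction adds up the vanishing boundaries along a line of cells; it starts at the border,
   where [Z] has no edges. *)
have Fh n (j : 'I_M.+1) : 0 < j -> n <= M -> F n (inord j.-1) (+) F n j = Z (true, (inord n, j)).
  move=> j0; elim: n => [_|n IHn nM]; first by rewrite !F0 Zout // /interior /= inordK.
  have := Z0 (inord n.+1, j); rewrite grid_bdryE /=; last by rewrite /interior /= inordK ?j0.
  rewrite inordK //= -IHn 1?ltnW // !FS.
  by case: (F n _); case: (F n _); do 3 ?case: (Z _).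
exists (fun c => F c.1 c.2) => -[[] [i j]]; rewrite /grid_left /grid_src /=.
  have [j0|j0] := posnP j; last first.
    by rewrite Fh ?inord_val // -ltnS ltn_ord.
  rewrite j0 /= -[X in inord X]j0 inord_val addbb Zout // /interior /= j0.
  by rewrite andbF.
have [i0|i0] := posnP i.
  by rewrite i0 /= inordK // addbb Zout // /interior /= i0.
have iM := ltn_ord i.
rewrite inordK; last by lia.
rewrite -[X in _ (+) F X j](prednK i0) FS prednK // inord_val.
by rewrite addbA addbb.
Qed.
End Grid.

(** * Minors given by connected sets of grid cells *)

Definition adj4 (c c' : nat * nat) :=
  (c.1 == c'.1) && ((c.2.+1 == c'.2) || (c'.2.+1 == c.2)) ||
  (c.2 == c'.2) && ((c.1.+1 == c'.1) || (c'.1.+1 == c.1)).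

Inductive conn4 (P : nat * nat -> Prop) (c : nat * nat) : nat * nat -> Prop :=
| conn4_refl : conn4 P c c
| conn4_step c1 c2 : conn4 P c c1 -> P c1 -> P c2 -> adj4 c1 c2 -> conn4 P c c2.

Section GridMinor.
Variables (V E : finType) (a b : E -> V) (M : nat).
Variables (br : nat * nat -> option V) (cen : V -> nat * nat).
Hypothesis a_neq_b : forall x, a x != b x.
Hypothesis simple : forall x y, [set a x; b x] = [set a y; b y] -> x = y.
Hypothesis br_range : forall c, br c -> (0 < c.1 <= M) && (0 < c.2 <= M).
Hypothesis links : forall x, exists c c',
  [/\ br c = Some (a x), br c' = Some (b x), adj4 c c',
      conn4 (fun d => br d = Some (a x)) (cen (a x)) c &
      conn4 (fun d => br d = Some (b x)) (cen (b x)) c'].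

Let C : finType := ('I_M.+1 * 'I_M.+1)%type.
Let Q : finType := (bool * C)%type.
Let s : Q -> C := @grid_src M.
Let t : Q -> C := @grid_tgt M.
Let toC (c : nat * nat) : C := (inord c.1, inord c.2).
Let brC (c : C) := br (c.1 : nat, c.2 : nat).

Lemma brC_toC c : br c -> brC (toC c) = br c.
Proof.
by case: c => i j /br_range /= /andP[/andP[_ iM] /andP[_ jM]]; rewrite /brC /= !inordK.
Qed.

Lemma adj4_grid c c' : br c -> br c' -> adj4 c c' ->
  exists q, s q = toC c /\ t q = toC c' \/ s q = toC c' /\ t q = toC c.
Proof.
move=> /br_range cM /br_range c'M; case: c c' cM c'M => [i j] [i' j'] /=.
move=> /andP[/andP[_ iM] /andP[_ jM]] /andP[/andP[_ iM'] /andP[_ jM']].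
rewrite /adj4 /toC /= => /orP[] /andP[/eqP<-] /orP[] /eqP<-.
- by exists (false, toC (i, j)); left; rewrite /s /t /grid_tgt /= inordK.
- by exists (false, toC (i, j')); right; rewrite /s /t /grid_tgt /= inordK.
- by exists (true, toC (i, j)); left; rewrite /s /t /grid_tgt /= inordK.
- by exists (true, toC (i', j)); right; rewrite /s /t /grid_tgt /= inordK.
Qed.

Lemma bdry1 q0 c : bdry s t (fun q => q0 == q) c = (s q0 == c) (+) (t q0 == c).
Proof. exact: big_addb_eq. Qed.

(** The edges of the path are added modulo 2; repeated edges may cancel, but the support stays
    inside the branch set. *)
Lemma conn4_chain v c c' : conn4 (fun d => br d = Some v) c c' ->
  exists W : Q -> bool, (forall q, W q -> inner s t brC q) /\
    forall d, bdry s t W d = (toC c == d) (+) (toC c' == d).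
Proof.
elim=> [|c1 c2 _ [W [Winn Wbd]] v1 v2 adj12].
  by exists (fun _ => false); split=> // d; rewrite addbb /bdry big1.
have b1 : br c1 by rewrite v1.
have b2 : br c2 by rewrite v2.
have [q qE] := adj4_grid b1 b2 adj12.
exists (fun q' => W q' (+) (q == q')); split=> [q'|d].
  case Wq: (W q'); first by move=> _; apply: Winn.
  move=> /eqP <-; rewrite /inner.
  by case: qE => -[-> ->]; rewrite !brC_toC // v1 v2 eqxx.
rewrite bdryD bdry1 Wbd; case: qE => -[-> ->];
by do 3 case: (_ == _).
Qed.

Lemma grid_minor_edge_bound : 2 < #|V| -> #|E| + 6 <= 3 * #|V|.
Proof.
have model x : exists qW : Q * (Q -> bool), let: (q, W) := qW in
  [/\ brC (s q) = Some (a x) /\ brC (t q) = Some (b x) \/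
      brC (s q) = Some (b x) /\ brC (t q) = Some (a x),
      W q, forall q', W q' -> q' = q \/ inner s t brC q' &
      forall c, bdry s t W c = (toC (cen (a x)) == c) (+) (toC (cen (b x)) == c)].
  have [c [c' [ca cb adj /conn4_chain[W1 [W1i W1b]] /conn4_chain[W2 [W2i W2b]]]]] := links x.
  have b1 : br c by rewrite ca.
  have b2 : br c' by rewrite cb.
  have [q qE] := adj4_grid b1 b2 adj.
  have q_ends : brC (s q) = Some (a x) /\ brC (t q) = Some (b x) \/
      brC (s q) = Some (b x) /\ brC (t q) = Some (a x).
    by case: qE => -[-> ->]; rewrite !brC_toC // ca cb; [left | right].
  have nq : inner s t brC q = false.
    by rewrite /inner; case: q_ends => -[-> ->] /=; rewrite (inj_eq Some_inj) ?(negPf (a_neq_b x)) //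
      eq_sym (negPf (a_neq_b x)).
  (* Centre of [a x] to [c], the link [q], then [c'] to the centre of [b x]. The link is not inner,
     so neither path can cancel it. *)
  exists (q, fun q' => (q == q') (+) (W1 q' (+) W2 q')); split=> //.
  - rewrite eqxx; case Wq: (W1 q); first by rewrite W1i in nq.
    by case Wq': (W2 q); first by rewrite W2i in nq.
  - move=> q'; have [->|_] := eqVneq q q'; first by left.
    by case Wq: (W1 q') => Wq'; right; [apply: W1i | apply: W2i].
  - move=> d; rewrite bdryD bdryD bdry1 W1b W2b.
    by case: qE => -[-> ->]; do 4 case: (_ == _).
have [qW qWP] := fin_all_exists model.
have cut (Z : Q -> bool) : (forall q, Z q -> brC (s q) && brC (t q)) -> (forall c, bdry s t Z c = false) ->
    exists f : C -> bool, forall q, Z q = f (grid_left q) (+) f (s q).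
  move=> Zbr Z0; apply: grid_cycle_cut => // q /Zbr /andP[/br_range /=].
  by rewrite /interior => /andP[/andP[-> _] /andP[-> _]].
have cyc (g : C -> bool) c : brC c ->
    bdry s t (fun q => g (grid_left q) (+) g (s q)) c = false.
  move=> /br_range /= /andP[/andP[i0 _] /andP[j0 _]].
  by apply: grid_cut_cycle; rewrite /interior i0.
apply: (@minor_edge_bound _ _ _ _ _ s t (@grid_left M) s a b brC (fun x => (qW x).1)
  (fun v => toC (cen v)) (fun x => (qW x).2)) => // x.
- by have := qWP x; case: (qW x) => q W [].
- by have := qWP x; case: (qW x) => q W [].
- by have := qWP x; case: (qW x) => q W [].
- by have := qWP x; case: (qW x) => q W [].
Qed.
End GridMinor.

Definition near k (c d : nat * nat) :=
  [&& c.1 <= d.1 + k, d.1 <= c.1 + k, c.2 <= d.2 + k & d.2 <= c.2 + k].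

Lemma near_sym k c d : near k c d = near k d c.
Proof. by rewrite /near; lia. Qed.

Lemma near_trans k k' d c c' : near k c d -> near k' d c' -> near (k + k') c c'.
Proof. by rewrite /near; lia. Qed.

(* Every vertex becomes a square of cells of radius [n], every edge a walk of cells that
   is cut down to the part between the two squares of its ends. *)
Section DiscreteDrawing.
Variables (V E : finType) (a b : E -> V) (n L M : nat).
Variables (cen : V -> nat * nat) (samp : E -> nat -> nat * nat).
Hypothesis a_neq_b : forall x, a x != b x.
Hypothesis simple : forall x y, [set a x; b x] = [set a y; b y] -> x = y.
Hypothesis n_gt0 : 0 < n.
Hypothesis samp0 : forall x, samp x 0 = cen (a x).
Hypothesis sampL : forall x, samp x L = cen (b x).
Hypothesis samp_step : forall x k, k < L -> near 1 (samp x k) (samp x k.+1).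
Hypothesis cen_far : forall v w, v != w -> ~~ near (n + n) (cen v) (cen w).
Hypothesis samp_far : forall x w k, w != a x -> w != b x -> k <= L ->
  ~~ near n.+1 (samp x k) (cen w).
Hypothesis samp_sep : forall x y k k', x != y -> k <= L -> k' <= L ->
  ~~ near n.-1 (samp x k) (cen (a x)) -> ~~ near n.-1 (samp x k) (cen (b x)) ->
  ~~ near n.-1 (samp y k') (cen (a y)) -> ~~ near n.-1 (samp y k') (cen (b y)) ->
  ~~ near 2 (samp x k) (samp y k').
Hypothesis cen_range : forall v,
  (n < (cen v).1 <= M) && (n < (cen v).2 <= M).
Hypothesis samp_range : forall x k, k <= L ->
  (1 < (samp x k).1 <= M) && (1 < (samp x k).2 <= M).

(* Cell number [2k + 1] of the walk is the corner that joins samples [k] and [k + 1]. *)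
Definition walk x i :=
  if odd i then ((samp x i./2.+1).1, (samp x i./2).2) else samp x i./2.

Lemma walk_near x i : i <= L.*2 -> near 1 (walk x i) (samp x i./2).
Proof.
rewrite /walk; case: ifP => oi iL; last by rewrite /near; lia.
by have := @samp_step x i./2; rewrite /near /=; lia.
Qed.

Lemma walk_step x i : i < L.*2 -> walk x i = walk x i.+1 \/ adj4 (walk x i) (walk x i.+1).
Proof.
move=> iL; have := @samp_step x i./2; rewrite /walk /= uphalf_half.
case: (odd i) => /=; rewrite ?add0n ?add1n /near /adj4 /=.
  case: (samp x i./2) (samp x i./2.+1) => p1 p2 [q1 q2] /= H.
  have [->|] := eqVneq p2 q2; first by left.
  by right; lia.
case: (samp x i./2) (samp x i./2.+1) => p1 p2 [q1 q2] /= H.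
have [->|] := eqVneq p1 q1; first by left.
by right; lia.
Qed.

Definition disc v c := near n c (cen v).

Lemma disc_inj v w c : disc v c -> disc w c -> v = w.
Proof.
rewrite /disc => dv dw; apply/eqP; apply: contraT => /cen_far /negP[].
by apply: near_trans dw; rewrite near_sym.
Qed.

(** [id] holds the start and the length of a shortest stretch from the square of [a x] to that of
    [b x]. Minimality keeps its interior off both squares; disjointness of the squares makes the
    length positive. *)
Lemma walk_cut x : exists id : nat * nat,
  [/\ 0 < id.2, id.1 + id.2 <= L.*2, disc (a x) (walk x id.1),
      disc (b x) (walk x (id.1 + id.2)) &
      forall k, 0 < k < id.2 ->
        ~~ disc (a x) (walk x (id.1 + k)) && ~~ disc (b x) (walk x (id.1 + k))].
Proof.
pose P d := [exists i : 'I_(L.*2).+1,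
  [&& i + d <= L.*2, disc (a x) (walk x i) & disc (b x) (walk x (i + d))]].
have exP : exists d, P d.
  exists L.*2; apply/existsP; exists ord0.
  rewrite /= add0n leqnn /walk odd_double /= doubleK samp0 sampL /disc /near /=; lia.
case: (ex_minnP exP) => d /existsP[i /and3P[idL Da Db]] min_d.
exists (nat_of_ord i, d); split=> //= [|k /andP[k0 kd]].
  case: d Db {idL min_d} => // Db; rewrite addn0 in Db.
  by have := a_neq_b x; rewrite (disc_inj Da Db) eqxx.
apply/andP; split; apply/negP=> D.
  have ikL : i + k < (L.*2).+1 by lia.
  have : d <= d - k; last by lia.
  apply: min_d; apply/existsP; exists (Ordinal ikL) => /=.
  by rewrite D -addnA subnKC ?(ltnW kd) // idL Db.
have : d <= k; last by lia.
by apply: min_d; apply/existsP; exists i; rewrite D Da !andbT; lia.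
Qed.

(** Induction on the taxicab distance [m]: a step towards the centre in one coordinate stays in the
    square. *)
Lemma disc_conn (P : nat * nat -> Prop) v c :
  (forall d, disc v d -> P d) -> disc v c -> conn4 P (cen v) c.
Proof.
move=> discP.
pose m c := (c.1 - (cen v).1) + ((cen v).1 - c.1) +
  ((c.2 - (cen v).2) + ((cen v).2 - c.2)).
have [k] := ubnP (m c); elim: k c => // k IHk [i j] mc Dc.
have step i' j' : adj4 (i', j') (i, j) -> near n (i', j') (cen v) -> m (i', j') < m (i, j) ->
    conn4 P (cen v) (i, j).
  move=> adj nr lt; apply: (@conn4_step _ _ (i', j')) => //; try exact: discP.
  by apply: IHk => //; rewrite ltnS in mc; apply: leq_trans mc.
move: Dc mc step; rewrite /disc /near /adj4 /m /=.
case Ec: (cen v) => [zi zj] /= Dc mc step.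
case: (ltngtP i zi) => Hi.
- by apply: (step i.+1 j); lia.
- by apply: (step i.-1 j); lia.
case: (ltngtP j zj) => Hj.
- by apply: (step i j.+1); lia.
- by apply: (step i j.-1); lia.
by rewrite Hi Hj; apply: conn4_refl.
Qed.

(** The branch set of [v] is its square together with the middle stretches of all edges [x] with
    [a x = v]. The last step of a stretch, into the square of [b x], is the link. *)
Lemma discrete_edge_bound : 2 < #|V| -> #|E| + 6 <= 3 * #|V|.
Proof.
have [id idP] := fin_all_exists walk_cut.
pose mid x c := [exists k : 'I_(id x).2, (0 < k) && (c == walk x ((id x).1 + k))].
have midP x c : mid x c -> exists2 j, j <= L &
    [/\ near 1 c (samp x j), ~~ disc (a x) c & ~~ disc (b x) c].
  have [_ idL _ _ far] := idP x.
  case/existsP=> k /andP[k0 /eqP->]; have kd := ltn_ord k.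
  exists ((id x).1 + k)./2; first by lia.
  have /andP[-> ->] := far k (introT andP (conj k0 kd)).
  by split=> //; apply: walk_near; lia.
have mid_disc x c v : mid x c -> ~~ disc v c.
  move=> /midP[j jL [nj na nb]].
  have [->//|nva] := eqVneq v (a x); have [->//|nvb] := eqVneq v (b x).
  apply: contra (samp_far nva nvb jL) => Dv.
  by rewrite -add1n; apply: near_trans Dv; rewrite near_sym.
(* A cell outside a square has its nearby sample outside radius n - 1, and samples near a common
   cell are within distance 2, which [samp_sep] forbids for different edges. *)
have mid_inj x y c : mid x c -> mid y c -> x = y.
  move=> /midP[j jL [nj na nb]] /midP[j' jL' [nj' na' nb']].
  have far z k : near 1 c (samp z k) -> forall v, ~~ disc v c -> ~~ near n.-1 (samp z k) (cen v).
    move=> nz v; apply: contra => nv; rewrite /disc -(prednK n_gt0) -add1n.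
    exact: near_trans nz nv.
  apply/eqP; apply: contraT => nxy.
  have /negP[] := samp_sep nxy jL jL' (far _ _ nj _ na) (far _ _ nj _ nb)
    (far _ _ nj' _ na') (far _ _ nj' _ nb').
  by apply: (@near_trans 1 1 c) => //; rewrite near_sym.
pose br c := if [pick v | disc v c] is Some v then Some v else
  if [pick x | mid x c] is Some x then Some (a x) else None.
have br_disc v c : disc v c -> br c = Some v.
  move=> Dv; rewrite /br; case: pickP => [w Dw|/(_ v)]; last by rewrite Dv.
  by rewrite (disc_inj Dv Dw).
have br_mid x c : mid x c -> br c = Some (a x).
  move=> mx; rewrite /br; case: pickP => [w Dw|_].
    by have := mid_disc _ _ w mx; rewrite Dw.
  by case: pickP => [y /(mid_inj _ _ _ mx)->//|/(_ x)]; rewrite mx.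
(* The margin [n] in [M + n] leaves room for the squares. *)
apply: (@grid_minor_edge_bound _ _ a b (M + n) br cen) => // [c|x].
  rewrite /br; case: pickP => [v Dv _|_].
    by have := cen_range v; move: Dv; rewrite /disc /near; lia.
  case: pickP => [x /midP[j jL [nj _ _]] _|//].
  by have := samp_range x jL; move: nj; rewrite /near; lia.
have [d0 idL Da Db far] := idP x.
have br_walk k : k < (id x).2 -> br (walk x ((id x).1 + k)) = Some (a x).
  have [->|k0] := posnP k; first by rewrite addn0 => _; apply: br_disc.
  by move=> kd; apply: br_mid; apply/existsP; exists (Ordinal kd); rewrite /= k0 eqxx.
have brb := br_disc _ _ Db; have dE := prednK d0.
exists (walk x ((id x).1 + (id x).2.-1)), (walk x ((id x).1 + (id x).2)).
split=> //; first by apply: br_walk; lia.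
- have := @walk_step x ((id x).1 + (id x).2.-1); rewrite -addnS dE => -[|eqw|//]; first by lia.
  have := br_walk (id x).2.-1; rewrite eqw brb => ba.
  have [ba'] : Some (b x) = Some (a x) by apply: ba; lia.
  by have := a_neq_b x; rewrite ba' eqxx.
- have : (id x).2.-1 < (id x).2 by lia.
  elim: (id x).2.-1 => [|k IHk] kd.
    by rewrite addn0; apply: disc_conn Da => d; apply: br_disc.
  have ck := IHk (ltnW kd).
  have := @walk_step x ((id x).1 + k); rewrite -addnS => -[|<-//|adj]; first by lia.
  by apply: (conn4_step ck) => //; apply: br_walk => //; apply: ltnW.
by apply: disc_conn Db => d; apply: br_disc.
Qed.
End DiscreteDrawing.
(** * Discretizing a planar drawing *)

Section PlaneCurves.
Local Open Scope R_scope.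

Definition dist (p q : R * R) := Rmax (Rabs (p.1 - q.1)) (Rabs (p.2 - q.2)).

Lemma dist_lt p q e : Rabs (p.1 - q.1) < e -> Rabs (p.2 - q.2) < e -> dist p q < e.
Proof. exact: Rmax_lub_lt. Qed.

Lemma dist_sym p q : dist p q = dist q p.
Proof. by rewrite /dist Rabs_minus_sym (Rabs_minus_sym p.2). Qed.

Lemma dist_triangle q p p' : dist p p' <= dist p q + dist q p'.
Proof.
have tri x y z : Rabs (x - z) <= Rabs (x - y) + Rabs (y - z).
  by have := Rabs_triang (x - y) (y - z); have -> : x - y + (y - z) = x - z by ring.
apply: Rmax_lub; apply: Rle_trans (tri _ _ _) _; apply: Rplus_le_compat.
- exact: Rmax_l.
- exact: Rmax_l.
- exact: Rmax_r.
- exact: Rmax_r.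
Qed.

Lemma dist_gt0 p q : p <> q -> 0 < dist p q.
Proof.
move=> npq; apply: Rnot_le_lt => d0; apply: npq.
have h1 := Rle_trans _ _ _ (Rmax_l _ _) d0.
have h2 := Rle_trans _ _ _ (Rmax_r _ _) d0.
move: h1 h2; case: p q {d0} => p1 p2 [q1 q2] /=.
by rewrite /Rabs; case: Rcase_abs => ?; case: Rcase_abs => ? h1 h2; congr (_, _); lra.
Qed.

Definition dcont (f : R -> R * R) := forall t0 e, 0 < e ->
  exists2 eta, 0 < eta & forall t, Rabs (t - t0) < eta -> dist (f t) (f t0) < e.

Lemma continuity_near (f : R -> R) t0 e : continuity f -> 0 < e ->
  exists2 eta, 0 < eta & forall t, Rabs (t - t0) < eta -> Rabs (f t - f t0) < e.
Proof.
move=> cf e0; have [eta [eta0 H]] := cf t0 e e0; exists eta => // t tt0.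
have [->|nt] := Req_dec t t0; first by rewrite Rminus_diag Rabs_R0.
by apply: H; split=> //; split=> //; apply: not_eq_sym.
Qed.

Lemma continuity_dcont f :
  continuity (fun t => fst (f t)) -> continuity (fun t => snd (f t)) -> dcont f.
Proof.
move=> c1 c2 t0 e e0.
have [eta1 p1 H1] := continuity_near t0 c1 e0; have [eta2 p2 H2] := continuity_near t0 c2 e0.
exists (Rmin eta1 eta2); first exact: Rmin_pos.
move=> t /Rmin_Rgt[lt1 lt2]; apply: dist_lt; [exact: H1 | exact: H2].
Qed.

(** Such a property passes to every smaller positive [e], so minima give common witnesses. *)
Definition antitone (P : R -> Prop) := forall e e', 0 < e' <= e -> P e -> P e'.

Lemma fin_uniform (I : finType) (P : I -> R -> Prop) :
  (forall i, antitone (P i)) -> (forall i, exists2 e, 0 < e & P i e) ->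
  exists2 e, 0 < e & forall i, P i e.
Proof.
move=> anti ex; suff [e e0 He] : exists2 e, 0 < e & forall i, i \in enum I -> P i e.
  by exists e => // i; apply: He; rewrite mem_enum.
elim: (enum I) => [|i s [e e0 IHs]]; first by exists 1; [lra|].
have [e' e0' Pi] := ex i; exists (Rmin e e'); first exact: Rmin_pos.
have m := Rmin_pos _ _ e0 e0'.
move=> j /predU1P[->|js]; first by apply: anti Pi; split=> //; apply: Rmin_r.
by apply: anti (IHs j js); split=> //; apply: Rmin_l.
Qed.

(* Compactness of the unit interval, relative to a closed set [K] of parameters. *)
Lemma compact_uniform (K : R -> Prop) (P : R -> R -> Prop) :
    (forall t, antitone (P t)) ->
    (forall t, 0 <= t <= 1 -> ~ K t ->
       exists2 eta, 0 < eta & forall t', Rabs (t' - t) < eta -> ~ K t') ->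
    (forall t, 0 <= t <= 1 -> K t -> exists2 eta, 0 < eta & exists2 e, 0 < e &
       forall t', Rabs (t' - t) < eta -> P t' e) ->
  exists2 e, 0 < e & forall t, 0 <= t <= 1 -> K t -> P t e.
Proof.
move=> anti openK loc.
have loc' t : 0 <= t <= 1 -> exists2 eta, 0 < eta & exists2 e, 0 < e &
    forall t', Rabs (t' - t) < eta -> K t' -> P t' e.
  move=> t01; have [Kt|nKt] := classic (K t).
    by have [eta eta0 [e e0 H]] := loc t t01 Kt; exists eta => //; exists e => // t' /H.
  have [eta eta0 H] := openK t t01 nKt; exists eta => //; exists 1; first lra.
  by move=> t' /H nK /nK.
(* The supremum [m] of [A] lies in [A] and must be 1: otherwise the local bound at [m] would extend
   the interval beyond it. *)
pose A c := 0 <= c <= 1 /\ exists2 e, 0 < e & forall t, 0 <= t <= c -> K t -> P t e.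
have A0 : A 0.
  split; first lra; have [|eta eta0 [e e0 H]] := loc' 0; first lra.
  exists e => // t t0; apply: H; have -> : t = 0 by lra.
  by rewrite Rminus_diag Rabs_R0.
have [||m [ubm lubm]] := completeness A; [by exists 1 => c [[]] | by exists 0|].
have m01 : 0 <= m <= 1 by split; [apply: ubm | apply: lubm => c [[]]].
have [eta eta0 [e e0 Hm]] := loc' m m01.
have [c [Ac mc]] : exists c, A c /\ m - eta < c.
  apply: NNPP => no; suff : m <= m - eta by lra.
  apply: lubm => c Ac; apply: Rnot_lt_le => lt; by apply: no; exists c.
have [c01 [e' e0' Hc]] := Ac; have cm := ubm c Ac.
have Am : A (Rmin (m + eta / 2) 1).
  split; first by rewrite /Rmin; case: Rle_dec; lra.
  have m0 := Rmin_pos _ _ e0 e0'.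
  exists (Rmin e e') => // t [t0 tm] Kt.
  have [tc|ct] := Rle_dec t c.
    by apply: anti (Hc t (conj t0 tc) Kt); split=> //; apply: Rmin_r.
  apply: anti (Hm t _ Kt); first by split=> //; apply: Rmin_l.
  have := Rmin_l (m + eta / 2) 1.
  by rewrite /Rabs; case: Rcase_abs; lra.
have := ubm _ Am; rewrite /Rmin; case: Rle_dec => [|_ le1m]; first lra.
have m1 : m = 1 by lra.
have [_ [e'' e0'' H]] := Am; exists e'' => // t t01; apply: H.
by rewrite m1 /Rmin; case: Rle_dec; lra.
Qed.

Lemma dcont_uniform f e : dcont f -> 0 < e -> exists2 eta, 0 < eta &
  forall t t', 0 <= t <= 1 -> Rabs (t' - t) < eta -> dist (f t') (f t) < e.
Proof.
move=> cf e0.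
have [|||eta eta0 H] := @compact_uniform (fun _ => True)
  (fun t eta => forall t', Rabs (t' - t) < eta -> dist (f t') (f t) < e).
- by move=> t eta eta' [_ le] H t' lt; apply: H; lra.
- by move=> t _ [].
- move=> t0 _ _; have e2 : 0 < e / 2 by lra.
  have [eta eta0 H] := cf t0 _ e2.
  exists (eta / 2); first lra; exists (eta / 2); first lra.
  move=> t tt0 t' t't; apply: Rle_lt_trans (dist_triangle (f t0) _ _) _.
  have : dist (f t) (f t0) < e / 2 by apply: H; lra.
  have : dist (f t') (f t0) < e / 2.
    apply: H; have -> : t' - t0 = (t' - t) + (t - t0) by ring.
    by apply: Rle_lt_trans (Rabs_triang _ _) _; lra.
  by rewrite (dist_sym (f t)); lra.
by exists eta => // t t' t01; apply: H.
Qed.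

(** Boundedness is phrased with a factor [e] so that it is antitone in [e] and [compact_uniform]
    applies. *)
Lemma dcont_bounded f p : dcont f ->
  exists2 e, 0 < e & forall t, 0 <= t <= 1 -> e * dist (f t) p <= 1.
Proof.
move=> cf.
have [|||e e0 H] := @compact_uniform (fun _ => True) (fun t e => e * dist (f t) p <= 1).
- move=> t e e' [_ le]; apply: Rle_trans; apply: Rmult_le_compat_r => //.
  exact: Rle_trans (Rabs_pos _) (Rmax_l _ _).
- by move=> t _ [].
- move=> t0 _ _; have [eta eta0 H] := cf t0 1 Rlt_0_1; exists eta => //.
  have d0 : 0 <= dist (f t0) p by apply: Rle_trans (Rabs_pos _) (Rmax_l _ _).
  exists (/ (1 + dist (f t0) p)); first by apply: Rinv_0_lt_compat; lra.
  move=> t /H lt1; apply: (Rmult_le_reg_l (1 + dist (f t0) p)); first lra.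
  rewrite -Rmult_assoc Rinv_r; last lra.
  by have := dist_triangle (f t0) (f t) p; lra.
by exists e => // t t01; apply: H.
Qed.

Lemma dcont_away f p : dcont f -> (forall t, 0 <= t <= 1 -> f t <> p) ->
  exists2 e, 0 < e & forall t, 0 <= t <= 1 -> e <= dist (f t) p.
Proof.
move=> cf fp.
have [|||e e0 H] := @compact_uniform (fun _ => True) (fun t e => e <= dist (f t) p).
- by move=> t e e' [_ le]; apply: Rle_trans.
- by move=> t _ [].
- move=> t0 t01 _; have d0 := dist_gt0 (fp t0 t01); have d2 : 0 < dist (f t0) p / 2 by lra.
  have [eta eta0 H] := cf t0 _ d2; exists eta => //; exists (dist (f t0) p / 2) => // t /H.
  by have := dist_triangle (f t) (f t0) p; rewrite (dist_sym (f t0) (f t)); lra.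
by exists e => // t t01; apply: H.
Qed.

(** A closed condition on [t], used as the set [K] of [compact_uniform] to cut off the ends of an
    arc. *)
Definition far rho (p q : R * R) (f : R -> R * R) t := rho <= dist (f t) p /\ rho <= dist (f t) q.

Lemma far_closed rho p q f t : dcont f -> ~ far rho p q f t ->
  exists2 eta, 0 < eta & forall t', Rabs (t' - t) < eta -> ~ far rho p q f t'.
Proof.
move=> cf nfar.
have one z : dist (f t) z < rho -> exists2 eta, 0 < eta &
    forall t', Rabs (t' - t) < eta -> dist (f t') z < rho.
  move=> lt; have d0 : 0 < rho - dist (f t) z by lra.
  have [eta eta0 H] := cf t _ d0; exists eta => // t' /H.
  by have := dist_triangle (f t) (f t') z; lra.
have [lep|/Rnot_le_lt/one[eta eta0 H]] := Rle_dec rho (dist (f t) p); last first.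
  by exists eta => // t' /H lt [le _]; lra.
have [leq|/Rnot_le_lt/one[eta eta0 H]] := Rle_dec rho (dist (f t) q); last first.
  by exists eta => // t' /H lt [_ le]; lra.
by case: nfar.
Qed.

Lemma arcs_separated rho p q p' q' f f' : dcont f -> dcont f' ->
    (forall s t, 0 <= s <= 1 -> 0 <= t <= 1 -> far rho p q f s -> far rho p' q' f' t ->
       f s <> f' t) ->
  exists2 e, 0 < e & forall s t, 0 <= s <= 1 -> 0 <= t <= 1 ->
    far rho p q f s -> far rho p' q' f' t -> e <= dist (f s) (f' t).
Proof.
move=> cf cf' disj.
have [|||e e0 H] := @compact_uniform (far rho p q f) (fun s e =>
  forall t, 0 <= t <= 1 -> far rho p' q' f' t -> e <= dist (f s) (f' t)).
- by move=> s e e' [_ le] H t t01 ft; apply: Rle_trans le (H t t01 ft).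
- by move=> s _; apply: far_closed.
- move=> s0 s01 fs0.
  have [|||e e0 H] := @compact_uniform (far rho p' q' f') (fun t e => e <= dist (f s0) (f' t)).
  + by move=> t e e' [_ le]; apply: Rle_trans.
  + by move=> t _; apply: far_closed.
  + move=> t0 t01 ft0; have d0 := dist_gt0 (disj _ _ s01 t01 fs0 ft0).
    have d2 : 0 < dist (f s0) (f' t0) / 2 by lra.
    have [eta eta0 H] := cf' t0 _ d2; exists eta => //; exists (dist (f s0) (f' t0) / 2) => // t /H.
    by have := dist_triangle (f' t) (f s0) (f' t0); lra.
  have e2 : 0 < e / 2 by lra.
  have [eta eta0 Hs] := cf s0 _ e2; exists eta => //; exists (e / 2) => // s /Hs lt t t01 ft.
  have := H t t01 ft; have := dist_triangle (f s) (f s0) (f' t).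
  by rewrite (dist_sym (f s0) (f s)); lra.
by exists e => // s t s01 t01 fs ft; apply: H.
Qed.

Lemma leq_INR (m n : nat) : (m <= n)%N -> INR m <= INR n.
Proof. by move/leP; apply: le_INR. Qed.

Lemma INR_ltn (m n : nat) : INR m < INR n -> (m < n)%N.
Proof. by move/INR_lt/ltP. Qed.

Lemma INR_addn (m n : nat) : INR (m + n) = INR m + INR n.
Proof. exact: plus_INR. Qed.

(** The cell of [r] is the floor of (r + O) / h; the offset [O] leaves more than [n] cells free
    below. *)
Lemma grid_coordinate (A h : R) (n : nat) : 0 < h -> exists (cell : R -> nat) (O : R) (M : nat),
  forall r, Rabs r <= A -> (n < cell r <= M)%N /\
    INR (cell r) * h <= r + O < (INR (cell r) + 1) * h.
Proof.
move=> h0; pose O := A + (INR n + 1) * h.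
have [M HM] := INR_archimed h (A + O) h0.
exists (fun r => Z.to_nat (Int_part ((r + O) / h))), O, M => r rA.
have rA' : - A <= r <= A by move: rA; rewrite /Rabs; case: Rcase_abs; lra.
have n0 := pos_INR n.
pose z := (r + O) / h; have zh : z * h = r + O by rewrite /z; field; lra.
have z0 : INR n + 1 <= z.
  apply: (Rmult_le_reg_r h) => //; rewrite zh /O; lra.
have [fz1 fz2] := base_Int_part z; rewrite -/z.
have zE : INR (Z.to_nat (Int_part z)) = IZR (Int_part z).
  rewrite INR_IZR_INZ Z2Nat.id //; apply: le_IZR.
  have : IZR (-1) < IZR (Int_part z) by lra.
  by move/lt_IZR => lt; apply: IZR_le; lia.
rewrite zE; split; last by rewrite -zh; split; [apply: Rmult_le_compat_r; lra | apply: Rmult_lt_compat_r; lra].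
apply/andP; split; first by apply: INR_ltn; rewrite zE; lra.
have : z < INR M by apply: (Rmult_lt_reg_r h) => //; rewrite zh; lra.
by move=> zM; rewrite ltnW // INR_ltn // zE; lra.
Qed.

(** * From a continuous drawing to the edge bound *)

Section PlanarDrawing.
Variables (V E : finType) (a b : E -> V) (pos : V -> R * R) (g : E -> R -> R * R).
Hypothesis a_neq_b : forall x, a x != b x.
Hypothesis simple : forall x y, [set a x; b x]%SET = [set a y; b y]%SET -> x = y.
Hypothesis pos_inj : injective pos.
Hypothesis g_cont : forall x, dcont (g x).
Hypothesis g0 : forall x, g x 0 = pos (a x).
Hypothesis g1 : forall x, g x 1 = pos (b x).
Hypothesis g_avoid : forall x t w, 0 < t < 1 -> g x t <> pos w.
Hypothesis g_disj : forall x y s t, x <> y -> 0 < s < 1 -> 0 < t < 1 -> g x s <> g y t.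

Lemma vertices_separated :
  exists2 rho, 0 < rho & forall v w, v != w -> rho <= dist (pos v) (pos w).
Proof.
have [||e e0 H] := @fin_uniform (V * V)%type
  (fun vw e => vw.1 != vw.2 -> e <= dist (pos vw.1) (pos vw.2)).
- by move=> vw e e' [_ le] H nvw; apply: Rle_trans le (H nvw).
- case=> v w /=; have [_|nvw] := eqVneq v w; first by exists 1; [lra|].
  by exists (dist (pos v) (pos w)); [apply: dist_gt0 => /pos_inj/eqP; apply/negP | lra].
by exists e => // v w; apply: (H (v, w)).
Qed.

Lemma vertices_off_arcs : exists2 rho, 0 < rho & forall x w t,
  w != a x -> w != b x -> 0 <= t <= 1 -> rho <= dist (g x t) (pos w).
Proof.
have [||e e0 H] := @fin_uniform (E * V)%type (fun xw e => xw.2 != a xw.1 -> xw.2 != b xw.1 ->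
  forall t, 0 <= t <= 1 -> e <= dist (g xw.1 t) (pos xw.2)).
- by move=> xw e e' [_ le] H na nb t t01; apply: Rle_trans le (H na nb t t01).
- case=> x w /=; have [_|na] := eqVneq w (a x); first by exists 1; [lra|].
  have [_|nb] := eqVneq w (b x); first by exists 1; [lra|].
  have [|e e0 H] := @dcont_away (g x) (pos w) (g_cont x); last by exists e.
  move=> t t01; have [->|t0] := Req_dec t 0.
    by rewrite g0 => /pos_inj wa; rewrite wa eqxx in na.
  have [->|t1] := Req_dec t 1; first by rewrite g1 => /pos_inj wb; rewrite wb eqxx in nb.
  by apply: g_avoid; lra.
by exists e => // x w t na nb; apply: (H (x, w)).
Qed.

(** Arcs with a common end come arbitrarily close there. Away from the ends both parameters are
    strictly between 0 and 1, where distinct arcs are disjoint. *)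
Lemma middles_separated rho : 0 < rho -> exists2 e, 0 < e & forall x y s t, x != y ->
  0 <= s <= 1 -> 0 <= t <= 1 -> far rho (pos (a x)) (pos (b x)) (g x) s ->
  far rho (pos (a y)) (pos (b y)) (g y) t -> e <= dist (g x s) (g y t).
Proof.
move=> rho0.
have dist0 p : dist p p = 0 by rewrite /dist !Rminus_diag Rabs_R0 Rmax_left //; lra.
have far01 x t : 0 <= t <= 1 -> far rho (pos (a x)) (pos (b x)) (g x) t -> 0 < t < 1.
  move=> t01 [fa fb]; have [t0|t0] := Req_dec t 0; first by rewrite t0 g0 dist0 in fa; lra.
  have [t1|t1] := Req_dec t 1; first by rewrite t1 g1 dist0 in fb; lra.
  lra.
have [||e e0 H] := @fin_uniform (E * E)%type (fun xy e => xy.1 != xy.2 -> forall s t,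
  0 <= s <= 1 -> 0 <= t <= 1 -> far rho (pos (a xy.1)) (pos (b xy.1)) (g xy.1) s ->
  far rho (pos (a xy.2)) (pos (b xy.2)) (g xy.2) t -> e <= dist (g xy.1 s) (g xy.2 t)).
- by move=> xy e e' [_ le] H nxy s t s01 t01 fs ft; apply: Rle_trans le (H nxy s t s01 t01 fs ft).
- case=> x y /=; have [_|nxy] := eqVneq x y; first by exists 1; [lra|].
  have [|e e0 H] := @arcs_separated rho (pos (a x)) (pos (b x)) (pos (a y)) (pos (b y))
      _ _ (g_cont x) (g_cont y); last by exists e.
  move=> s t s01 t01 /(far01 _ _ s01) s01' /(far01 _ _ t01) t01'.
  by apply: g_disj => //; apply/eqP.
by exists e => // x y s t nxy; apply: (H (x, y)).
Qed.

Lemma drawing_bounded : exists2 A, 0 < A &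
  (forall x t, 0 <= t <= 1 -> dist (g x t) (0, 0) <= A) /\
  (forall v, dist (pos v) (0, 0) <= A).
Proof.
have [||e e0 H] := @fin_uniform E
  (fun x e => forall t, 0 <= t <= 1 -> e * dist (g x t) (0, 0) <= 1).
- move=> x e e' [_ le] H t t01; apply: Rle_trans (H t t01); apply: Rmult_le_compat_r => //.
  exact: Rle_trans (Rabs_pos _) (Rmax_l _ _).
- by move=> x; apply: dcont_bounded.
have [||e' e0' H'] := @fin_uniform V (fun v e => e * dist (pos v) (0, 0) <= 1).
- move=> v e1 e2 [_ le] H1; apply: Rle_trans H1; apply: Rmult_le_compat_r => //.
  exact: Rle_trans (Rabs_pos _) (Rmax_l _ _).
- move=> v; have [//|e1 e10 H1] := @dcont_bounded (fun _ => pos v) (0, 0).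
    by move=> t0 e1 e10; exists 1 => [|*]; [lra|]; rewrite /dist !Rminus_diag Rabs_R0 Rmax_left //; lra.
  by exists e1 => //; apply: (H1 0); lra.
have inv e1 d : 0 < e1 -> e1 * d <= 1 -> d <= / e1.
  move=> e10 le; apply: (Rmult_le_reg_l e1) => //; rewrite Rinv_r; lra.
have i1 := Rinv_0_lt_compat _ e0; have i2 := Rinv_0_lt_compat _ e0'.
exists (/ e + / e'); first lra; split=> [x t t01|v].
  by have := inv _ _ e0 (H x t t01); lra.
by have := inv _ _ e0' (H' v); lra.
Qed.

(** The mesh is h = rho / n, so squares of radius [n] have size about rho. Nearness 2n or n + 1
    would give distances below 2 rho + h or rho + 2h, both less than 4 rho; nearness 2 would give
    less than 3h < delta. *)
Lemma drawing_edge_bound : (2 < #|V|)%N -> (#|E| + 6 <= 3 * #|V|)%N.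
Proof.
have [r1 r10 Hr1] := vertices_separated; have [r2 r20 Hr2] := vertices_off_arcs.
pose rho := Rmin r1 r2 / 4.
have rho0 : 0 < rho by have := Rmin_pos _ _ r10 r20; rewrite /rho; lra.
have rho1 : 4 * rho <= r1 by have := Rmin_l r1 r2; rewrite /rho; lra.
have rho2 : 4 * rho <= r2 by have := Rmin_r r1 r2; rewrite /rho; lra.
have rhoh0 : 0 < rho / 2 by lra.
have [delta delta0 Hdelta] := middles_separated rhoh0.
have [A A0 [gA posA]] := drawing_bounded.
have [n n2 Hn] : exists2 n, (1 < n)%N & 3 * rho < INR n * delta.
  have [n Hn] := INR_archimed delta (3 * rho) delta0; exists n.+2 => //.
  by rewrite !S_INR !Rmult_plus_distr_r; lra.
have nge2 : 2 <= INR n by exact: (leq_INR n2).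
pose h := rho / INR n; have nh : INR n * h = rho by rewrite /h; field; lra.
have h0 : 0 < h by apply: Rdiv_lt_0_compat; lra.
have h2 : 2 * h <= rho by rewrite -nh; apply: Rmult_le_compat_r; lra.
have h3 : 3 * h < delta.
  apply: (Rmult_lt_reg_l (INR n)); first lra.
  by rewrite (Rmult_comm 3) -Rmult_assoc nh; lra.
have [cell [O [M cellP]]] := @grid_coordinate A h n h0.
pose cellp (p : R * R) := (cell p.1, cell p.2).
pose inbox p := dist p (0, 0) <= A.
have inbox_coord p : inbox p -> Rabs p.1 <= A /\ Rabs p.2 <= A.
  rewrite /inbox /dist !Rminus_0_r => le.
  by split; [apply: Rle_trans (Rmax_l _ _) le | apply: Rle_trans (Rmax_r _ _) le].
have cell_le r r' k : Rabs r <= A -> Rabs r' <= A -> (cell r <= cell r' + k)%N ->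
    r - r' < (INR k + 1) * h.
  move=> /cellP[_ [_ c1]] /cellP[_ [c2 _]] /leq_INR; rewrite INR_addn => le.
  have := Rmult_le_compat_r h _ _ (Rlt_le _ _ h0) le.
  by move: c1 c2; rewrite !Rmult_plus_distr_r; lra.
have cell_gt r r' k : Rabs r <= A -> Rabs r' <= A -> r - r' <= INR k * h ->
    (cell r <= cell r' + k)%N.
  move=> /cellP[_ [c1 _]] /cellP[_ [_ c2]] le; rewrite -ltnS; apply: INR_ltn.
  rewrite S_INR INR_addn; apply: (Rmult_lt_reg_r h) => //.
  by move: c1 c2; rewrite !Rmult_plus_distr_r; lra.
have near_dist k p q : inbox p -> inbox q -> near k (cellp p) (cellp q) -> dist p q < (INR k + 1) * h.
  move=> /inbox_coord[p1 p2] /inbox_coord[q1 q2] /and4P[/= l1 l2 l3 l4].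
  have := (cell_le _ _ _ p1 q1 l1, cell_le _ _ _ q1 p1 l2, cell_le _ _ _ p2 q2 l3,
          cell_le _ _ _ q2 p2 l4).
  move=> [[[d1 d2] d3] d4].
  by apply: dist_lt; rewrite /Rabs; case: Rcase_abs; lra.
have dist_near k p q : inbox p -> inbox q -> dist p q <= INR k * h -> near k (cellp p) (cellp q).
  move=> /inbox_coord[p1 p2] /inbox_coord[q1 q2] le.
  have := Rle_trans _ _ _ (Rmax_l _ _) le; have := Rle_trans _ _ _ (Rmax_r _ _) le.
  rewrite /Rabs; case: Rcase_abs => ?; case: Rcase_abs => ? ? ?;
  by apply/and4P; split; apply: cell_gt => //; lra.
have [||eta eta0 Heta] := @fin_uniform E (fun x eta => forall t t', 0 <= t <= 1 ->
    Rabs (t' - t) < eta -> dist (g x t') (g x t) < h).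
- by move=> x e e' [_ le] H t t' t01 lt; apply: H => //; lra.
- by move=> x; apply: dcont_uniform.
(* The time step 1 / L is below [eta], so consecutive samples are less than [h] apart and their
   cells touch. *)
have [L [HL L0]] := archimed_cor1 eta eta0.
have L0' : 0 < INR L by apply: lt_0_INR.
pose time k := INR k / INR L.
have time01 k : (k <= L)%N -> 0 <= time k <= 1.
  move=> /leq_INR le; have k0 := pos_INR k; split.
    by apply: Rmult_le_pos => //; apply/Rlt_le/Rinv_0_lt_compat.
  by apply: (Rmult_le_reg_r (INR L)) => //; rewrite /time Rmult_1_l; field_simplify; lra.
have gin x k : (k <= L)%N -> inbox (g x (time k)) by move=> /time01; apply: gA.
have far_time x k : (k <= L)%N ->
    ~~ near n.-1 (cellp (g x (time k))) (cellp (pos (a x))) ->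
    ~~ near n.-1 (cellp (g x (time k))) (cellp (pos (b x))) ->
    far (rho / 2) (pos (a x)) (pos (b x)) (g x) (time k).
  (* Radius n - 1 means rho - h, which is at least rho / 2 because n >= 2. *)
  have n1 : INR n.-1 * h = rho - h.
    by rewrite -nh -[in RHS](prednK (ltnW n2)) S_INR; ring.
  move=> kL na nb; split; apply: Rnot_lt_le => lt.
    by case/negP: na; apply: dist_near; [exact: gin|exact: posA|rewrite n1; lra].
  by case/negP: nb; apply: dist_near; [exact: gin|exact: posA|rewrite n1; lra].
apply: (@discrete_edge_bound _ _ a b n L M (fun v => cellp (pos v))
  (fun x k => cellp (g x (time k)))) => //.
- exact: ltnW.
- by move=> x; rewrite /time /= Rdiv_0_l g0.
- by move=> x; rewrite /time Rdiv_diag ?g1 //; lra.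
- move=> x k kL; rewrite near_sym; apply: dist_near; try (apply: gin; lia).
  rewrite Rmult_1_l; apply/Rlt_le/Heta; first by apply: time01; lia.
  rewrite /time S_INR; have -> : (INR k + 1) / INR L - INR k / INR L = / INR L by field; lra.
  by rewrite Rabs_pos_eq //; apply/Rlt_le/Rinv_0_lt_compat.
- move=> v w nvw; apply/negP=> /near_dist H; have := H (posA v) (posA w).
  by have := Hr1 v w nvw; rewrite (INR_addn n n) !Rmult_plus_distr_r nh; lra.
- move=> x w k na nb kL; apply/negP=> /near_dist H; have := H (gin x k kL) (posA w).
  by have := Hr2 x w _ na nb (time01 k kL); rewrite (S_INR n) !Rmult_plus_distr_r nh; lra.
- move=> x y k k' nxy kL kL' fa fb fa' fb'; apply/negP=> /near_dist H.
  have := H (gin x k kL) (gin y k' kL').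
  have := Hdelta x y _ _ nxy (time01 k kL) (time01 k' kL') (far_time x k kL fa fb)
    (far_time y k' kL' fa' fb').
  by rewrite /=; lra.
- move=> v; have [p1 p2] := inbox_coord _ (posA v).
  by rewrite (cellP _ p1).1 (cellP _ p2).1.
- move=> x k kL; have [p1 p2] := inbox_coord _ (gin x k kL).
  by have [h1 _] := cellP _ p1; have [h2' _] := cellP _ p2; move: h1 h2'; rewrite /cellp /=; lia.
Qed.

End PlanarDrawing.
End PlaneCurves.

(** * Planar graphs *)

Section PlanarGraphs.
Variables (T : finType) (e : rel T).
Hypotheses (e_sym : symmetric e) (e_irr : irreflexive e).

(** Ordering the ends by [enum_rank] lists every edge exactly once. *)
Definition edge : finType :=
  {uv : T * T | e uv.1 uv.2 && (enum_rank uv.1 < enum_rank uv.2)}.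

Lemma edge_ends_inj (x y : edge) :
  [set (val x).1; (val x).2] = [set (val y).1; (val y).2] -> x = y.
Proof.
case: x y => [[u v] /= uvP] [[u' v'] /= uvP'] eq_ends; apply: val_inj => /=.
case/andP: uvP => _ /= ruv; case/andP: uvP' => _ /= ruv'.
have /set2P ux : u \in [set u'; v'] by rewrite -eq_ends set21.
have /set2P vx : v \in [set u'; v'] by rewrite -eq_ends set22.
case: ux vx ruv ruv' => -> [] -> //; rewrite ?ltnn // => lt lt'.
by have := ltn_trans lt lt'; rewrite ltnn.
Qed.

(** Handshake: the ordered adjacent pairs split into increasing and decreasing ones, exchanged by
    the swap. *)
Lemma deg_sum_edges : deg_sum e [set: T] = 2 * #|edge|.
Proof.
pose lt_edge := [set uv : T * T | e uv.1 uv.2 && (enum_rank uv.1 < enum_rank uv.2)].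
pose gt_edge := [set uv : T * T | e uv.1 uv.2 && (enum_rank uv.2 < enum_rank uv.1)].
have -> : #|edge| = #|lt_edge| by rewrite card_sig; apply: eq_card => uv; rewrite !inE.
have -> : deg_sum e [set: T] = #|lt_edge :|: gt_edge|.
  rewrite /deg_sum /deg_in -sum1_card.
  under eq_bigr do rewrite -sum1_card.
  rewrite pair_big_dep; apply: eq_bigl => -[u v] /=.
  rewrite !inE /= -andb_orr -neq_ltn (inj_eq val_inj) (inj_eq enum_rank_inj).
  by case: eqVneq => [->|_]; rewrite ?e_irr ?andbT.
rewrite cardsU; have -> : lt_edge :&: gt_edge = set0.
  by apply/setP=> -[u v]; rewrite !inE /=; case: ltngtP; rewrite ?andbF.
have swap_inj : injective (fun uv : T * T => (uv.2, uv.1)) by move=> [? ?] [? ?] [-> ->].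
have -> : gt_edge = [set (uv.2, uv.1) | uv in lt_edge].
  apply/setP=> -[u v]; rewrite inE /=; apply/idP/imsetP => [/andP[euv r]|[[u' v']]].
    by exists (v, u); rewrite ?inE //= e_sym euv.
  by rewrite inE /= => /andP[euv r] [-> ->]; rewrite e_sym euv.
by rewrite card_imset // cards0 subn0 addnn mul2n.
Qed.

Lemma planar_deg_sum : planar e -> 2 < #|T| -> deg_sum e [set: T] + 12 <= 6 * #|T|.
Proof.
case=> pos [arc [pos_inj [arcP arc_disj]]] T3.
have eP (x : edge) : e (val x).1 (val x).2 by case/andP: (valP x).
suff : #|edge| + 6 <= 3 * #|T| by rewrite deg_sum_edges; lia.
apply: (@drawing_edge_bound _ _ (fun x : edge => (val x).1) (fun x : edge => (val x).2)
  pos (fun x : edge => arc (val x).1 (val x).2)) => //.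
- by move=> x; apply: contraTneq (eP x) => ->; rewrite e_irr.
- exact: edge_ends_inj.
- by move=> x; have [c1 [c2 _]] := arcP _ _ (eP x); apply: continuity_dcont.
- by move=> x; have [_ [_ [-> _]]] := arcP _ _ (eP x).
- by move=> x; have [_ [_ [_ [-> _]]]] := arcP _ _ (eP x).
- by move=> x t w t01; have [_ [_ [_ [_ [_ H]]]]] := arcP _ _ (eP x); apply: H.
move=> x y s t nxy; apply: arc_disj => //.
by apply/eqP => /edge_ends_inj.
Qed.
End PlanarGraphs.

(* The numerical bounds *)
From mathcomp Require Import lra.
Import Order.TTheory GRing.Theory Num.Theory.
Local Open Scope ring_scope.

Theorem mainTheorem6 (T : finType) (e : rel T) :
  symmetric e -> irreflexive e -> planar e -> (3 <= #|T|)%N ->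
  ((inv_diam 3 e)%:R : rat) <= 11 / 6 * #|T|%:R - 8 / 3 /\
  (inv_diam 5 e <= inv_diam 4 e)%N /\
  ((inv_diam 4 e)%:R : rat) <= 4 / 3 * #|T|%:R + 10 / 3.
Proof.
move=> e_sym e_irr e_planar T3.
have deg12 := planar_deg_sum e_sym e_irr e_planar T3.
have deg6 : (deg_sum e [set: T] <= 6 * #|T|)%N by lia.
have b3 := @inv_diam_leq T e e_sym e_irr 2 isT (ltnW T3) deg6.
have b4 := @inv_diam_leq T e e_sym e_irr 3 isT (ltnW T3) deg6.
(* With degree sum at most 6n - 12 these read 7n/4 - 3 and 4n/3 - 2, which are below the claimed
   bounds. *)
have {}b3 : (4 * inv_diam 3 e + 12 <= 7 * #|T|)%N by lia.
have {}b4 : (6 * inv_diam 4 e + 12 <= 8 * #|T|)%N by lia.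
rewrite -(ler_nat rat) natrD !natrM in b3.
rewrite -(ler_nat rat) natrD !natrM in b4.
have n0 : 0 <= #|T|%:R :> rat by apply: ler0n.
by split; [lra | split; [apply: inv_diam_anti | lra]].
Qed.
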